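(* Let $S$ be a compact metrizable space and let $\boldsymbol{X}=(X_0,X_1,\dots)$ be a sequence of $S$-valued random variables on a probability space $(\Omega,\mathscr{F},\mathbb{P})$. Assume $\boldsymbol{\xi}=(\xi_0,\xi_1,\dots)$ is a product disintegration of $\boldsymbol{X}$, and let $f\colon S\to\mathbb{R}$ be continuous. Then $$\lim_{n\to\infty}\frac{1}{n}\sum_{i=0}^{n-1}\big(f(X_i)-\xi_i(f)\big)=0\qquad\text{almost surely}.$$ In particular, the limit $X_\infty(f):=\lim_{n\to\infty}n^{-1}\sum_{i=0}^{n-1}f(X_i)$ exists almost surely if and only if the limit $\xi_\infty(f):=\lim_{n\to\infty}n^{-1}\sum_{i=0}^{n-1}\xi_i(f)$ exists almost surely, in which case $X_\infty(f)=\xi_\infty(f)$ almost surely.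
   Context: $S$ carries its Borel $\sigma$-field. $M_1(S)$ denotes the set of Borel probability measures on $S$ with the topology of weak* convergence ($\mu_n\to\mu$ iff $\int f\,d\mu_n\to\int f\,d\mu$ for every continuous $f\colon S\to\mathbb{R}$) and the corresponding Borel $\sigma$-field. A random probability measure on $S$ is a Borel measurable map $\xi\colon\Omega\to M_1(S)$, whose value at $\omega$ is written $\xi^\omega$. For $\mu\in M_1(S)$ and $f\colon S\to\mathbb{R}$ bounded measurable, $\mu(f):=\int_S f\,d\mu$; thus $\xi_i(f)$ is the random variable $\omega\mapsto\int_S f\,d\xi_i^\omega$. Product disintegration: a sequence $\boldsymbol{\xi}=(\xi_0,\xi_1,\dots)$ of random probability measures on $S$, defined on the same probability space as $\boldsymbol{X}$, is a product disintegration of $\boldsymbol{X}$ iff, with probability one, the equality $$\mathbb{P}[X_0\in A_0,\dots,X_n\in A_n\mid\boldsymbol{\xi}]=\xi_0(A_0)\cdots\xi_n(A_n)$$ holds for each $n\in\mathbb{N}=\{0,1,2,\dots\}$ and each family $A_0,\dots,A_n$ of measurable subsets of $S$. Here $\mathbb{P}[\,\cdot\mid\boldsymbol{\xi}]$ is (a regular version of) the conditional distribution of $\boldsymbol{X}$ given $\sigma(\boldsymbol{\xi})$, so the condition says that for almost every $\omega$ the measure $\mathbb{P}(\boldsymbol{X}\in\cdot\mid\boldsymbol{\xi})_\omega$ on $S^{\mathbb{N}}$ is the product measure $\prod_{n}\xi_n^\omega$. *)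

(* Defs.v *)
From HB Require Import structures.
From mathcomp Require Import all_boot all_order all_algebra.
From mathcomp Require Import all_classical all_reals all_analysis.

Set Implicit Arguments.
Unset Strict Implicit.
Unset Printing Implicit Defensive.

Import Order.TTheory GRing.Theory Num.Theory.
Import numFieldNormedType.Exports.

Local Open Scope classical_set_scope.
Local Open Scope ring_scope.

Definition metrizable (R : realType) (S : topologicalType) : Prop :=
  exists d : S -> S -> R,
    [/\ forall x y, d x y = 0 <-> x = y,
        forall x y, d x y = d y x,
        forall x y z, d x z <= d x y + d y z &
        forall (x : S) (A : set S),
          nbhs x A <-> exists2 e : R, 0 < e & [set y | d x y < e] `<=` A].

Definition borel (S : ptopologicalType) := g_sigma_algebraType (@open S).

Definition integrals (R : realType) (S : ptopologicalType)
    (mu : probability (borel S) R) : {ptws continuousType S R -> R} :=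
  fun f => \int[mu]_x f x.

(* The coarsest topology making [mu |-> \int[mu]_x f x] continuous for every
   continuous [f]; its convergence is described by [weakstar_cvgP]. *)
Definition weakstar (R : realType) (S : ptopologicalType) : ptopologicalType :=
  initial_topology (@integrals R S).

Lemma weakstar_cvgP (R : realType) (S : ptopologicalType)
    (F : set_system (weakstar R S)) (mu : weakstar R S) : Filter F ->
  F --> mu <->
  forall f : continuousType S R,
    (fun nu : probability (borel S) R => \int[nu]_x f x) @ F -->
      \int[(mu : probability (borel S) R)]_x f x.
Proof.
move=> FF; split=> [Fmu f|Fmu A].
  exact: (cvg_comp _ _ (cvg_comp _ _ Fmu (@initial_continuous _ _ _ mu))
    (@proj_continuous _ (fun=> R) f (integrals mu))).
rewrite nbhsE => -[_ [[B oB <-] Bmu]] BA; apply: filterS BA _.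
suff FB : @integrals R S @ F --> (integrals mu : {ptws _ -> R}).
  by apply: FB; exact: open_nbhs_nbhs.
apply/cvg_sup => f C; rewrite nbhsE => -[_ [[D oD <-] Dmu]] DC.
by apply: filterS DC _; apply: (Fmu f); exact: open_nbhs_nbhs.
Qed.

(* Not to be confused with the library's [pprobability], whose sigma-algebra
   is generated by the evaluations [mu |-> mu A]. *)
Definition M1 (R : realType) (S : ptopologicalType) := borel (weakstar R S).

Definition seqspace d (E : measurableType d) :=
  g_sigma_algebraType
    (\bigcup_n preimage_set_system setT (fun x : nat -> E => x n) measurable).

(* [k] is a regular version of the conditional distribution of [Y] given the
   sigma-algebra generated by [Z]. The source of [k] is the sample space with
   that sigma-algebra, so that each [k ^~ B] is sigma(Z)-measurable. *)
Definition regular_conditional_distribution d dE dF (Omega : measurableType d)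
    (E : measurableType dE) (F : measurableType dF) (R : realType)
    (P : probability Omega R) (Y : Omega -> E) (Z : Omega -> F)
    (k : R.-pker (g_sigma_algebra_preimageType Z) ~> E) : Prop :=
  forall (G : set Omega) (B : set E),
    g_sigma_algebra_preimage Z G -> measurable B ->
    P (G `&` Y @^-1` B) = (\int[P]_(w in G) k w B)%E.

Definition product_disintegration d (Omega : measurableType d) (R : realType)
    (S : ptopologicalType) (P : probability Omega R)
    (X : nat -> {RV P >-> borel S}) (xi : nat -> {RV P >-> M1 R S}) : Prop :=
  let bX : Omega -> seqspace (borel S) := fun w n => X n w in
  let bxi : Omega -> seqspace (M1 R S) := fun w n => xi n w in
  exists2 k : R.-pker (g_sigma_algebra_preimageType bxi) ~>
                      seqspace (borel S),
    regular_conditional_distribution P bX k &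
    {ae P, forall w, forall (n : nat) (A : 'I_n.+1 -> set (borel S)),
      (forall i, measurable (A i)) ->
      k w [set x : nat -> S | forall i : 'I_n.+1, A i (x i)] =
      (\prod_(i < n.+1) (xi i w : probability (borel S) R) (A i))%E}.

Definition average (R : realType) (u : nat -> R) (n : nat) : R :=
  n%:R^-1 * \sum_(0 <= i < n) u i.

Definition mean (R : realType) (S : ptopologicalType) (mu : M1 R S)
    (f : S -> R) : R :=
  \int[(mu : probability (borel S) R)]_x f x.

(* Main.v *)
(** Given the disintegration, the conditional law [k w] of [X] is, for almost
    every [w], the product of the measures [xi i w]. Under a product law the
    variables [f (x i)], centered at their means, are bounded and pairwise
    orthogonal, so their averages have summable second moments along the squares
    and converge to 0 almost surely, first along the squares and then, by
    boundedness, along all integers. The pairs [(w, x)] for which the centered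
    averages converge form a measurable set [A], whose sections have full
    [k w]-measure almost surely, and the joint law of [(w, X w)] integrates
    [k w]; hence [(w, X w)] lies in [A] almost surely. *)
Require Import Defs.
From HB Require Import structures.
From mathcomp Require Import all_boot all_order all_algebra.
From mathcomp Require Import all_classical all_reals all_analysis.
From mathcomp Require Import measurable_realfun ring lra.
Import Order.TTheory GRing.Theory Num.Theory.
Import numFieldNormedType.Exports.
Local Open Scope classical_set_scope.
Local Open Scope ring_scope.

Set Implicit Arguments.
Unset Strict Implicit.

(** * Averages of bounded sequences along the squares *)

Lemma averageB (R : realType) (u v : nat -> R) :
  average (fun i => u i - v i) = average u \- average v.
Proof. by apply/funext => n; rewrite /average sumrB mulrBr. Qed.

Lemma sqrt_bracket (N : nat) : exists n, (n ^ 2 <= N < n.+1 ^ 2)%N.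
Proof.
elim: N => [|N [n /andP[nN Nn]]]; first by exists 0.
have [lt|ge] := ltnP N.+1 (n.+1 ^ 2).
  by exists n; rewrite lt (leq_trans nN).
by exists n.+1; rewrite ge /= (leq_ltn_trans Nn)// ltn_sqr.
Qed.

Lemma sum_bounded_le (R : realType) (u : nat -> R) (M : R) (m n : nat) :
  (forall i, `|u i| <= M) -> (m <= n)%N ->
  `|\sum_(0 <= i < n) u i| <= `|\sum_(0 <= i < m) u i| + (n - m)%:R * M.
Proof.
move=> uM mn; rewrite (big_cat_nat (leq0n m) mn)//=.
apply: (le_trans (ler_normD _ _)); rewrite lerD2l.
apply: (le_trans (ler_norm_sum _ _ _)).
apply: (le_trans (ler_sum _ (fun i _ => uM i))).
by rewrite big_const_nat iter_addr addr0 mulr_natl.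
Qed.

(* Between consecutive squares, n^2 <= N < (n+1)^2, a bounded summand changes
   the average by at most 2nM/N <= 2M/n. *)
Lemma cvg_average_squares (R : realType) (u : nat -> R) (M : R) :
  (forall i, `|u i| <= M) ->
  average u (n.+1 ^ 2)%N @[n --> \oo] --> (0 : R) ->
  average u @ \oo --> (0 : R).
Proof.
move=> uM u0; have M0 : 0 <= M by exact: le_trans (uM 0).
have : (average u (n.+1 ^ 2)%N : R) @[n --> \oo] --> (0 : R) by [].
move=> /cvgr0Pnorm_lt sq; apply/cvgr0Pnorm_lt => e e0.
have e20 : 0 < e / 2 by rewrite divr_gt0.
have [n0 _ Hn0] := sq _ e20.
(* Once [n1 < n], both halves of [e] are available: [n > 4M/e] gives [2M/n < e/2], and [n > n0]
   allows the hypothesis on squares to be used at [n]. *)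
pose n1 := maxn n0 (Num.truncn (4 * M / e)).+1.
exists (n1.+1 ^ 2)%N => // N /= HN.
have [n /andP[nN Nn]] := sqrt_bracket N.
have n1n : (n1 < n)%N.
  by have := leq_ltn_trans HN Nn; rewrite ltn_sqr ltnS.
have n_gt0 : (0 < n)%N by exact: leq_ltn_trans n1n.
have nR : 0 < n%:R :> R by rewrite ltr0n.
have NR : 0 < N%:R :> R by rewrite ltr0n (leq_trans _ nN)// expn_gt0 n_gt0.
(* The squares are indexed as [m.+1 ^ 2], so [n ^ 2] has index [n.-1]. *)
have := Hn0 n.-1; rewrite /= prednK// => /(_ _)/wrap[].
  by rewrite -ltnS prednK// (leq_trans _ n1n)// ltnS leq_maxl.
have avgE k : `|average u k| = k%:R^-1 * `|\sum_(0 <= i < k) u i|.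
  by rewrite /average normrM ger0_norm// invr_ge0.
rewrite !avgE => Sn.
have Me : 2 * M / n%:R < e / 2.
  have : 4 * M / e < n%:R.
    apply: (lt_le_trans (truncnS_gt _)).
    by rewrite ler_nat (leq_trans _ (ltnW n1n))// leq_maxr.
  by rewrite ltr_pdivrMr// ltr_pdivrMr// => ?; lra.
have nNR : n%:R ^+ 2 <= N%:R :> R by rewrite -natrX ler_nat.
(* Since [N < n.+1 ^ 2], at most [2 * n] summands lie beyond the first [n ^ 2], each bounded by
   [M]. *)
apply: (le_lt_trans (y := N%:R^-1 *
    (`|\sum_(0 <= i < n ^ 2) u i| + (2 * n)%:R * M))).
  rewrite ler_pM2l ?invr_gt0//.
  apply: (le_trans (sum_bounded_le uM nN)).
  rewrite lerD2l ler_wpM2r// ler_nat leq_subLR -ltnS (leq_trans Nn)//.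
  by rewrite -[n.+1]addn1 sqrnD exp1n muln1 addnAC addn1.
rewrite mulrDr [ltRHS](splitr e) ltr_leD//.
  apply: le_lt_trans Sn; rewrite natrX ler_wpM2r// lef_pV2// posrE.
  by rewrite exprn_gt0.
rewrite ltW// (le_lt_trans _ Me)// natrM mulrC ler_pdivrMr//.
apply: (@le_trans _ _ (2 * M / n%:R * n%:R ^+ 2)).
  by rewrite le_eqVlt; apply/orP; left; apply/eqP; field; rewrite gt_eqF.
by rewrite ler_wpM2l// divr_ge0// mulr_ge0.
Qed.

(** * Strong law for bounded, pairwise orthogonal variables *)

Lemma bounded_integrable d (T : measurableType d) (R : realType)
    (Q : probability T R) (g : T -> R) (M : R) :
  measurable_fun setT g -> (forall x, `|g x| <= M) ->
  Q.-integrable setT (EFin \o g).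
Proof.
move=> mg gM; apply: measurable_bounded_integrable => //.
  exact: (le_lt_trans (probability_le1 Q measurableT) (ltry _)).
exists M; split; first by rewrite num_real.
by move=> N MN x _ /=; rewrite (le_trans (gM x))// ltW.
Qed.

(** Induction on [n]: when the square of the sum gains the term [Y n], the cross term integrates to
    0 by orthogonality and the new square contributes at most [M ^+ 2]. *)
Lemma Rintegral_sum_sqr_le d (T : measurableType d) (R : realType)
    (Q : probability T R) (Y : nat -> T -> R) (M : R) (n : nat) :
  (forall i, measurable_fun setT (Y i)) ->
  (forall i x, `|Y i x| <= M) ->
  (forall i j, (i < j)%N -> \int[Q]_x (Y i x * Y j x) = 0) ->
  \int[Q]_x ((\sum_(0 <= i < n) Y i x) ^+ 2) <= n%:R * M ^+ 2.
Proof.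
move=> mY YM orth.
have mS m : measurable_fun setT (fun x => \sum_(0 <= i < m) Y i x).
  exact: measurable_sum.
have SM m x : `|\sum_(0 <= i < m) Y i x| <= m%:R * M.
  have := sum_bounded_le (YM^~ x) (leq0n m).
  by rewrite big_nil normr0 add0r subn0.
have M0 : 0 <= M by apply: le_trans (YM 0 point).
have iYY i j : Q.-integrable setT (EFin \o (fun x => Y i x * Y j x)).
  apply: (bounded_integrable _ (M := M * M)).
    exact: measurable_funM.
  by move=> x; rewrite normrM ler_pM.
have iSY m j : Q.-integrable setT
    (EFin \o (fun x => (\sum_(0 <= i < m) Y i x) * Y j x)).
  apply: (bounded_integrable _ (M := m%:R * M * M)).
    exact: measurable_funM.
  by move=> x; rewrite normrM ler_pM.
have SY m j : (m <= j)%N -> \int[Q]_x ((\sum_(0 <= i < m) Y i x) * Y j x) = 0.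
  elim: m => [_|m IH mj].
    under eq_Rintegral do rewrite big_nil mul0r.
    by rewrite Rintegral_cst// mul0r.
  under eq_Rintegral do rewrite big_nat_recr//= mulrDl.
  by rewrite RintegralD//= IH ?(ltnW mj)// orth// addr0.
elim: n => [|n IH].
  under eq_Rintegral do rewrite big_nil expr0n.
  by rewrite Rintegral_cst// !mul0r.
have iS2 : Q.-integrable setT
    (EFin \o (fun x => (\sum_(0 <= i < n) Y i x) ^+ 2)).
  apply: (bounded_integrable _ (M := (n%:R * M) ^+ 2)).
    exact: measurable_funX.
  by move=> x; rewrite normrX lerXn2r// nnegrE// mulr_ge0.
rewrite [X in X <= _](_ : _ = \int[Q]_x ((\sum_(0 <= i < n) Y i x) ^+ 2 +
    (2 * ((\sum_(0 <= i < n) Y i x) * Y n x) + Y n x * Y n x))); last first.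
  by apply: eq_Rintegral => x _; rewrite big_nat_recr//=; ring.
have i2SY : Q.-integrable setT
    (EFin \o (fun x => 2 * ((\sum_(0 <= i < n) Y i x) * Y n x))).
  exact: (integrableZl measurableT 2 (iSY n n)).
rewrite RintegralD//; last exact: (integrableD measurableT i2SY (iYY n n)).
rewrite RintegralD//.
rewrite RintegralZl// SY// mulr0 add0r -natr1 mulrDl mul1r lerD//.
rewrite -[leRHS]mulr1 -[X in _ * X](_ : fine (Q setT) = 1); last first.
  by rewrite probability_setT.
rewrite -Rintegral_cst//; apply: le_Rintegral => //.
  exact: (bounded_integrable _ (g := cst (M ^+ 2)) (M := `|M ^+ 2|)).
move=> x _; rewrite (le_trans (ler_norm _))// normrM expr2 ler_pM//.
Qed.

(** The average over [n.+1 ^ 2] terms has second moment at most [M ^+ 2 / n.+1 ^ 2], which is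
    summable. The series of squared averages is therefore integrable, hence finite almost
    everywhere, so its terms tend to 0; [cvg_average_squares] then fills the gaps between
    squares. *)
Lemma slln_orthogonal d (T : measurableType d) (R : realType)
    (Q : probability T R) (Y : nat -> T -> R) (M : R) :
  (forall i, measurable_fun setT (Y i)) ->
  (forall i x, `|Y i x| <= M) ->
  (forall i j, (i < j)%N -> \int[Q]_x (Y i x * Y j x) = 0) ->
  {ae Q, forall x, average (Y^~ x) @ \oo --> (0 : R)}.
Proof.
move=> mY YM orth.
pose V n x := average (Y^~ x) (n.+1 ^ 2)%N.
have mV n : measurable_fun setT (V n).
  by apply: measurable_funM => //; exact: measurable_sum.
have V2 n : (\int[Q]_x ((V n x) ^+ 2)%:E <= (M ^+ 2 * (n.+1%:R ^- 2))%:E)%E.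
  have iS : Q.-integrable setT (EFin \o (fun x =>
      (\sum_(0 <= i < n.+1 ^ 2) Y i x) ^+ 2)).
    apply: (bounded_integrable _ (M := ((n.+1 ^ 2)%:R * M) ^+ 2)).
      by apply: measurable_funX; exact: measurable_sum.
    move=> x; rewrite normrX lerXn2r// ?nnegrE//.
      by rewrite mulr_ge0// (le_trans _ (YM 0 point)).
    have := sum_bounded_le (YM^~ x) (leq0n (n.+1 ^ 2)).
    by rewrite big_nil normr0 add0r subn0.
  rewrite /V /average; under eq_integral do rewrite exprMn EFinM.
  rewrite integralZl// -(@fineK _ (\int[Q]_x _)%E); last first.
    exact: integrable_fin_num.
  rewrite -EFinM lee_fin.
  have := Rintegral_sum_sqr_le (n.+1 ^ 2) mY YM orth.
  rewrite /Rintegral => /ler_wpM2l => /(_ ((n.+1 ^ 2)%:R^-1 ^+ 2)).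
  move=> /(_ (sqr_ge0 _))/le_trans; apply.
  rewrite le_eqVlt; apply/orP; left; apply/eqP; rewrite natrX; field.
  by rewrite nat1r pnatr_eq0.
(* Telescoping: for [a >= 1], [2/a - 2/(a+1) - 1/a^2] equals [(a-1)/(a^2 (a+1))], which is
   nonnegative. *)
have sumfin N : \sum_(0 <= n < N) n.+1%:R ^- 2 <= 2 - 2 / N.+1%:R :> R.
  elim: N => [|N IH]; first by rewrite big_nil divr1 subrr.
  rewrite big_nat_recr//=.
  have step (a : R) : 1 <= a -> a ^- 2 <= 2 / a - 2 / (a + 1).
    move=> a1; have a0 : 0 < a by exact: lt_le_trans a1.
    have a10 : 0 < a + 1 by rewrite addr_gt0.
    rewrite -subr_ge0 [X in 0 <= X](_ : _ = (a - 1) / (a ^+ 2 * (a + 1))).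
      by rewrite divr_ge0 ?subr_ge0// mulr_ge0 ?sqr_ge0// ltW.
    by field; rewrite !gt_eqF.
  have := step N.+1%:R; rewrite ler1n natr1 => /(_ isT) {}step.
  by rewrite (le_trans (lerD IH step))// addrA subrK.
have int_fin : (\int[Q]_x (\sum_(n <oo) ((V n x) ^+ 2)%:E) < +oo)%E.
  rewrite integral_nneseries//; last 2 first.
  - by move=> n; apply/measurable_EFinP; exact: measurable_funX.
  - by move=> n x _; rewrite lee_fin sqr_ge0.
  apply: (@le_lt_trans _ _ (\sum_(n <oo) (M ^+ 2 * (n.+1%:R ^- 2))%:E)%E).
    apply: lee_nneseries => // n _ _.
    by apply: integral_ge0 => x _; rewrite lee_fin sqr_ge0.
  apply: (@le_lt_trans _ _ (M ^+ 2 * 2)%:E); last exact: ltry.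
  apply: lime_le.
    apply: is_cvg_nneseries => n _ _.
    by rewrite lee_fin mulr_ge0// sqr_ge0.
  apply: nearW => N; rewrite sumEFin lee_fin -mulr_sumr ler_wpM2l ?sqr_ge0//.
  by rewrite (le_trans (sumfin N))// gerBl.
have : Q.-integrable setT (fun x => \sum_(n <oo) ((V n x) ^+ 2)%:E)%E.
  apply/integrableP; split.
    apply: ge0_emeasurable_sum => [n x _ _|n _].
      by rewrite lee_fin sqr_ge0.
    by apply/measurable_EFinP; exact: measurable_funX.
  under eq_integral => x _.
    rewrite gee0_abs; first over.
    by apply: nneseries_ge0 => n _ _; rewrite lee_fin sqr_ge0.
  exact: int_fin.
move=> /(integrable_ae measurableT); apply: filterS => x /(_ I) Vfin.
apply: (cvg_average_squares (M := M)) => //.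
apply/cvgr0Pnorm_lt => e e0.
have V0 n : (0 <= ((V n x) ^+ 2)%:E)%E by rewrite lee_fin sqr_ge0.
(* The tails of a finite nonnegative series vanish, and each tail dominates its first term. *)
have tail0 : ((\sum_(N <= n <oo) ((V n x) ^+ 2)%:E)%E @[N --> \oo] --> 0%:E).
  by apply: nneseries_tail_cvg => //; move: Vfin; rewrite fin_numElt => /andP[].
have : ((V n x ^+ 2)%:E @[n --> \oo] --> 0%:E)%E.
  apply: (squeeze_cvge _ _ tail0); last exact: cvg_cst.
  apply: nearW => n; rewrite V0 /=.
  have := nneseries_lim_ge (m := n) (P := xpredT) n.+1 (fun k _ _ => V0 k).
  by rewrite big_nat1.
(* The threshold [e ^+ 2] for the squares becomes [e] for the averages themselves. *)
move=> /fine_cvgP[_] /cvgr0Pnorm_lt /(_ (e ^+ 2)).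
rewrite exprn_gt0// => /(_ isT); apply: filterS => n /=.
rewrite normrX => lt; rewrite ltNge; apply/negP => ge.
by move: lt; rewrite ltNge lerXn2r// nnegrE// ltW.
Qed.

(** * Product laws on the sequence space *)

Lemma measurable_coordinate d (E : measurableType d) (i : nat) :
  measurable_fun setT (fun x : seqspace E => x i).
Proof.
move=> _ B mB; apply: sub_sigma_algebra; exists i => //.
by exists B.
Qed.

(** Phrased on finite cylinders, as in [product_disintegration], so that no infinite product measure
    has to be built. [Q] is a plain measure, so that the predicate applies directly to a kernel
    value [k w]. *)
Definition is_product_law d (E : measurableType d) (R : realType)
    (Q : {measure set (seqspace E) -> \bar R})
    (mu : nat -> probability E R) : Prop :=
  forall (n : nat) (A : 'I_n.+1 -> set E), (forall i, measurable (A i)) ->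
    Q [set x : nat -> E | forall i : 'I_n.+1, A i (x i)] =
    (\prod_(i < n.+1) mu i (A i))%E.

(** The event is a cylinder over the coordinates up to [j] whose sides other than [A] and [B] are
    the whole space; those factors equal 1. *)
Lemma product_law_pair d (E : measurableType d) (R : realType)
    (Q : {measure set (seqspace E) -> \bar R}) (mu : nat -> probability E R)
    (i j : nat) (A B : set E) :
  is_product_law Q mu -> (i < j)%N -> measurable A -> measurable B ->
  Q [set x : nat -> E | A (x i) /\ B (x j)] = (mu i A * mu j B)%E.
Proof.
move=> prodQ ij mA mB.
pose C (l : 'I_j.+1) :=
  if val l == i then A else if val l == j then B else setT.
have mC l : measurable (C l) by rewrite /C; do 2 case: ifP => // _.
have iP : (i < j.+1)%N by rewrite ltnS ltnW.
transitivity (Q [set x : nat -> E | forall l : 'I_j.+1, C l (x l)]).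
  congr (Q _); apply/seteqP; split => x /=.
    move=> [Ax Bx] l; rewrite /C; case: eqP => [->//|_].
    by case: eqP => [->|].
  move=> Cx; split.
    by have := Cx (Ordinal iP); rewrite /C/= eqxx.
  by have := Cx ord_max; rewrite /C/= gtn_eqF// eqxx.
rewrite prodQ// (bigD1 (Ordinal iP))//= (bigD1 ord_max)/=; last first.
  by rewrite -val_eqE/= gtn_eqF.
rewrite big1 ?mule1; last first.
  move=> l /andP[]; rewrite -!val_eqE/= => /negbTE li /negbTE lj.
  by rewrite /C/= li lj probability_setT.
by rewrite /C/= eqxx gtn_eqF// eqxx.
Qed.

Lemma product_law_marginal d (E : measurableType d) (R : realType)
    (Q : {measure set (seqspace E) -> \bar R}) (mu : nat -> probability E R)
    (i : nat) (A : set E) :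
  is_product_law Q mu -> measurable A ->
  Q [set x : nat -> E | A (x i)] = mu i A.
Proof.
move=> prodQ mA.
rewrite -[RHS]mule1 -(probability_setT (mu i.+1)).
rewrite -(product_law_pair prodQ (ltnSn i) mA measurableT).
by congr (Q _); apply/seteqP; split => x //= [].
Qed.

(** Change of variables: the image of [Q] under the [i]-th coordinate is [mu i]. *)
Lemma product_law_Rintegral d (E : measurableType d) (R : realType)
    (Q : probability (seqspace E) R) (mu : nat -> probability E R)
    (g : E -> R) (M : R) (i : nat) :
  is_product_law Q mu -> measurable_fun setT g ->
  (forall a, `|g a| <= M) ->
  \int[Q]_x g (x i) = \int[mu i]_a g a.
Proof.
move=> prodQ mg gM; rewrite /Rintegral; congr fine.
pose phi : {mfun seqspace E >-> E} :=
  HB.pack (fun x : seqspace E => x i)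
    (isMeasurableFun.Build _ _ _ _ _ (measurable_coordinate i)).
transitivity (\int[distribution Q phi]_a (g a)%:E)%E.
  rewrite integral_distribution//; first exact/measurable_EFinP.
  apply: (bounded_integrable _ (g := g \o phi)) => [|x]; last exact: gM.
  exact: measurableT_comp.
apply: (eq_measure_integral (mu i)) => A mA _.
exact: product_law_marginal.
Qed.

(** The image of [Q] under the pair of coordinates agrees with [mu i \x mu j] on rectangles, hence
    everywhere. By Fubini the inner integral, over the second variable, is a multiple of the mean of
    a centered function, which is 0. *)
Lemma product_law_orthogonal d (E : measurableType d) (R : realType)
    (Q : probability (seqspace E) R) (mu : nat -> probability E R)
    (g : E -> R) (M : R) (i j : nat) :
  is_product_law Q mu -> measurable_fun setT g ->
  (forall a, `|g a| <= M) -> (i < j)%N ->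
  \int[Q]_x ((g (x i) - \int[mu i]_a g a) * (g (x j) - \int[mu j]_a g a)) = 0.
Proof.
move=> prodQ mg gM ij.
set m := fun l => \int[mu l]_a g a.
have M0 : 0 <= M by apply: le_trans (gM point).
have mgB l : measurable_fun setT (fun a => g a - m l) by exact: measurable_funB.
have gBM l a : `|g a - m l| <= M + `|m l|.
  by rewrite (le_trans (ler_normB _ _))// lerD2r.
pose h (z : E * E) := (g z.1 - m i) * (g z.2 - m j).
have mh : measurable_fun setT h.
  apply: measurable_funM; first exact: (measurableT_comp (mgB i)).
  exact: (measurableT_comp (mgB j)).
have hM z : `|h z| <= (M + `|m i|) * (M + `|m j|) by rewrite normrM ler_pM.
have mphi : measurable_fun setT (fun x : seqspace E => (x i, x j)).
  by apply: measurable_fun_pair; exact: measurable_coordinate.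
pose phi : {mfun seqspace E >-> (E * E)%type} :=
  HB.pack (fun x : seqspace E => (x i, x j))
    (isMeasurableFun.Build _ _ _ _ _ mphi).
have -> : \int[Q]_x ((g (x i) - m i) * (g (x j) - m j)) =
    fine (\int[mu i \x mu j]_z (h z)%:E)%E.
  rewrite /Rintegral; congr fine.
  transitivity (\int[distribution Q phi]_z (h z)%:E)%E.
    rewrite integral_distribution//; first exact/measurable_EFinP.
    apply: (bounded_integrable _ (g := h \o phi)); last by move=> x; exact: hM.
    exact: measurableT_comp.
  apply: eq_measure_integral => X mX _; apply/esym.
  apply: product_measure_unique => // A B mA mB.
  exact: product_law_pair.
rewrite -(integral12_prod_meas1 (f := EFin \o h)); last first.
  exact: (bounded_integrable (mu i \x mu j)%E mh hM).
have ig : (mu j).-integrable setT (EFin \o g).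
  exact: (bounded_integrable _ mg gM).
have icst : (mu j).-integrable setT (EFin \o cst (m j)).
  exact: (bounded_integrable _ (M := `|m j|)).
have centered : (\int[mu j]_b (g b - m j)%:E = 0)%E.
  under eq_integral do rewrite EFinB.
  rewrite integralB//= integral_cst// [X in (_ * X)%E]probability_setT mule1.
  rewrite /m /Rintegral fineK ?integrable_fin_num//.
  by rewrite subee// integrable_fin_num.
rewrite /fubini_F; under eq_integral => a _.
  under eq_integral do rewrite /= /h/= EFinM.
  rewrite integralZl//; last exact: (bounded_integrable _ (mgB j) (gBM j)).
  rewrite centered mule0; over.
by rewrite integral0.
Qed.

(** The means are written as integrals against [Q], although they equal those of the factors [mu i]:
    with [Q] a kernel value, this form varies measurably with the parameter. *)
Lemma slln_product_law d (E : measurableType d) (R : realType)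
    (Q : probability (seqspace E) R) (mu : nat -> probability E R)
    (g : E -> R) (M : R) :
  is_product_law Q mu -> measurable_fun setT g ->
  (forall a, `|g a| <= M) ->
  {ae Q, forall x : seqspace E,
    average (fun i => g (x i) - \int[Q]_y g (y i)) @ \oo --> (0 : R)}.
Proof.
move=> prodQ mg gM.
have mE i := product_law_Rintegral i prodQ mg gM.
(* The means inherit the bound [M], so the centered variables are bounded by [M + M]. *)
have mM i : `|\int[Q]_y g (y i)| <= M.
  have mgi : measurable_fun setT (fun x : seqspace E => g (x i)).
    exact: (measurableT_comp mg (measurable_coordinate i)).
  have igi := bounded_integrable Q mgi (fun x => gM (x i)).
  rewrite (le_trans (le_normr_Rintegral _ igi))//.
  rewrite -[leRHS]mulr1 -[X in _ * X](_ : fine (Q setT) = 1); last first.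
    by rewrite probability_setT.
  rewrite -Rintegral_cst//; apply: le_Rintegral => //.
    by apply: (bounded_integrable _ (M := M)) => [|x];
      [exact: measurableT_comp|rewrite normr_id].
  exact: (bounded_integrable _ (g := cst M) (M := `|M|)).
apply: (slln_orthogonal (M := M + M)
  (Y := fun i (x : seqspace E) => g (x i) - \int[Q]_y g (y i))).
- move=> i; apply: measurable_funB => //.
  exact: (measurableT_comp mg (measurable_coordinate i)).
- by move=> i x; rewrite (le_trans (ler_normB _ _))// lerD.
- move=> i j ij; under eq_Rintegral do rewrite !mE.
  exact: (product_law_orthogonal (M := M)).
Qed.

(** * Conditional laws and the joint law of a point and its image *)

(** Kernels here have as source the sample space with the sigma-algebra of [Z], while [P] lives on
    the full one; this transfers measurability from the former to the latter. *)
Lemma measurable_fun_sub_preimage d (Omega : measurableType d)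
    dF (F : measurableType dF) (Z : Omega -> F)
    dU (U : measurableType dU) (h : Omega -> U) :
  measurable_fun setT Z ->
  measurable_fun [set: g_sigma_algebra_preimageType Z] h ->
  measurable_fun [set: Omega] h.
Proof.
move=> mZ mh _ B mB.
have [C mC <-] := mh measurableT B mB.
exact: mZ.
Qed.

Lemma measurable_fun_preimage_graph d (Omega : measurableType d) dE
    (E : measurableType dE) dF (F : measurableType dF)
    (Y : Omega -> E) (Z : Omega -> F) :
  measurable_fun setT Y -> measurable_fun setT Z ->
  measurable_fun [set: Omega]
    (fun w => (w, Y w) : g_sigma_algebra_preimageType Z * E).
Proof.
move=> mY mZ; apply: measurable_fun_pair => //.
apply: (measurable_fun_sub_preimage (Z := Z)
  (h := idfun : _ -> g_sigma_algebra_preimageType Z)) => //.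
by move=> _ B mB; rewrite setTI.
Qed.

(* Both sides are measures in [A] that agree on rectangles by hypothesis. *)
Lemma conditional_joint_law d (Omega : measurableType d) dE
    (E : measurableType dE) dF (F : measurableType dF) (R : realType)
    (P : probability Omega R) (Y : Omega -> E) (Z : Omega -> F)
    (k : R.-pker (g_sigma_algebra_preimageType Z) ~> E)
    (A : set (g_sigma_algebra_preimageType Z * E)) :
  measurable_fun setT Y -> measurable_fun setT Z ->
  regular_conditional_distribution P Y k -> measurable A ->
  P [set w | A (w, Y w)] = (\int[P]_w k w (xsection A w))%E.
Proof.
move=> mY mZ rcd mA.
have mgraph := measurable_fun_preimage_graph mY mZ.
pose graph : {mfun Omega >-> (g_sigma_algebra_preimageType Z * E)%type} :=
  HB.pack (fun w => (w, Y w) : g_sigma_algebra_preimageType Z * E)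
    (isMeasurableFun.Build _ _ _ _ _ mgraph).
pose joint (B : set (g_sigma_algebra_preimageType Z * E)) :=
  (\int[P]_w k w (xsection B w))%E.
have mk (B : set (g_sigma_algebra_preimageType Z * E)) : measurable B ->
    measurable_fun [set: Omega] (fun w => k w (xsection B w)).
  move=> mB; apply: (measurable_fun_sub_preimage (Z := Z)) => //.
  by apply: measurable_fun_xsection_finite_kernel; rewrite inE.
have joint0 : joint set0 = 0%E.
  by apply: integral0_eq => w _; rewrite xsection0 measure0.
have joint_ge0 B : (0 <= joint B)%E by exact: integral_ge0.
have jointD : semi_sigma_additive joint.
  move=> B mB tB mUB.
  rewrite [X in _ --> X](_ : _ =
      (\sum_(n <oo) \int[P]_w k w (xsection (B n) w))%E).
    by apply: is_cvg_nneseries => n _ _; exact: integral_ge0.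
  rewrite -integral_nneseries//; last by move=> n; exact: mk.
  apply: eq_integral => w _.
  rewrite xsection_bigcup measure_bigcup//.
  - by apply: eq_eseriesl => n; rewrite in_setT.
  - by move=> n _; exact: measurable_xsection.
  - exact: trivIset_xsection.
pose m : {measure set (g_sigma_algebra_preimageType Z * E) -> \bar R} :=
  HB.pack joint (isMeasure.Build _ _ _ joint joint0 joint_ge0 jointD).
(* Rectangles are stable under intersection and generate the product sigma-algebra; the constant
   sequence [setT] exhausts the space with mass 1. *)
apply: (measure_unique
  [set B `*` C | B in @measurable _ (g_sigma_algebra_preimageType Z)
               & C in @measurable _ E] (fun=> setT)
  _ _ _ _ (distribution P graph) m) => //.
- exact: measurable_prod_measurableType.
- move=> _ _ [B1 mB1 [C1 mC1 <-]] [B2 mB2 [C2 mC2 <-]].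
  exists (B1 `&` B2); first exact: measurableI.
  by exists (C1 `&` C2); [exact: measurableI|rewrite setXI].
- by move=> _; exists setT => //; exists setT => //; rewrite setXTT.
- by rewrite bigcup_const.
- move=> _ [B mB [C mC <-]].
  (* The section of [B] times [C] at [w] is [C] or empty according to whether [w] lies in [B], so
     the claim on rectangles is the defining identity of [k]. *)
  rewrite /distribution /pushforward /= /joint.
  rewrite [LHS](rcd B C)// integral_mkcond; apply: eq_integral => w _.
  rewrite patchE; case: ifPn => wB; first by rewrite in_xsectionX.
  by rewrite notin_xsectionX// measure0.
- move=> _; rewrite (_ : _ setT = 1%E) ?ltry//.
  exact: (probability_setT (distribution P graph)).
Qed.

(** Almost every section of the complement of [A] is null for [k w], so the joint law, which
    integrates these section masses, gives the complement mass 0. *)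
Lemma conditional_law_ae d (Omega : measurableType d) dE
    (E : measurableType dE) dF (F : measurableType dF) (R : realType)
    (P : probability Omega R) (Y : Omega -> E) (Z : Omega -> F)
    (k : R.-pker (g_sigma_algebra_preimageType Z) ~> E)
    (A : set (g_sigma_algebra_preimageType Z * E)) :
  measurable_fun setT Y -> measurable_fun setT Z ->
  regular_conditional_distribution P Y k -> measurable A ->
  {ae P, forall w, {ae k w, forall y, A (w, y)}} ->
  {ae P, forall w, A (w, Y w)}.
Proof.
move=> mY mZ rcd mA aeA.
have mAC : measurable (~` A) by exact: measurableC.
have mgraph := measurable_fun_preimage_graph mY mZ.
exists [set w | (~` A) (w, Y w)]; split => //.
  by rewrite -[X in measurable X]setTI; exact: (mgraph measurableT (~` A)).
rewrite (conditional_joint_law mY mZ rcd)//.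
transitivity (\int[P]_w (cst 0 w : \bar R))%E; last exact: integral0.
apply: ae_eq_integral => //.
  apply: (measurable_fun_sub_preimage (Z := Z)) => //.
  by apply: measurable_fun_xsection_finite_kernel; rewrite inE.
move: aeA; apply: (@filterS _ _ (ae_filter_ringOfSetsType P)) => w aew _ /=.
have mx : measurable (xsection (~` A) w) by exact: measurable_xsection.
apply/(measure_negligible mx); apply: negligibleS aew => y.
by rewrite /xsection/= inE.
Qed.

(** * Measurability of sequences, of convergence events and of kernel integrals *)

Lemma measurable_fun_seqspace d (Omega : measurableType d) dE
    (E : measurableType dE) (h : nat -> Omega -> E) :
  (forall n, measurable_fun setT (h n)) ->
  measurable_fun setT (fun w => (fun n => h n w) : seqspace E).
Proof.
move=> mh.
apply: (@measurability _ _ Omega (seqspace E) setT (fun w n => h n w)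
  (\bigcup_n preimage_set_system setT (fun x : nat -> E => x n) measurable)
  erefl) => _ [_ [n _ [B mB <-]] <-].
by rewrite (setTI (_ @^-1` B)); exact: mh.
Qed.

(** Testing convergence only with the tolerances [m.+1%:R^-1] makes the event a countable
    combination of measurable sets. *)
Lemma measurable_cvg0 d (T : measurableType d) (R : realType)
    (h : nat -> T -> R) :
  (forall n, measurable_fun setT (h n)) ->
  measurable [set z | h^~ z @ \oo --> (0 : R)].
Proof.
move=> mh.
rewrite (_ : [set _ | _] =
    \bigcap_m \bigcup_N \bigcap_(n in [set n | (N <= n)%N])
      ((fun z => `|h n z|) @^-1` `]-oo, m.+1%:R^-1[)).
  apply: bigcap_measurable => // m _; apply: bigcup_measurable => N _.
  apply: bigcap_measurable => [|n _]; first by exists N => /=.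
  rewrite -[X in measurable X]setTI.
  by apply: (measurableT_comp (@normr_measurable R setT) (mh n)).
apply/seteqP; split => z /=.
  move=> /cvgr0Pnorm_lt hz m _.
  have [|N _ HN] := hz m.+1%:R^-1; first by rewrite invr_gt0.
  by exists N => // n /= Nn; rewrite in_itv/=; exact: HN.
move=> hz; apply/cvgr0Pnorm_lt => e e0.
(* This index [m] satisfies [e^-1 < m.+1], so the tolerance is below [e]. *)
have [N _ HN] := hz (Num.truncn e^-1) I.
exists N => // n /= /HN; rewrite /= in_itv/= => /lt_trans; apply.
by rewrite invf_plt ?posrE// truncnS_gt.
Qed.

Lemma measurable_fun_Rintegral_kernel d d' (T : measurableType d)
    (E : measurableType d') (R : realType) (k : R.-ker T ~> E) (g : E -> R) :
  measurable_fun setT g -> measurable_fun setT (fun w => \int[k w]_y g y).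
Proof.
move=> mg; rewrite /Rintegral.
apply: (measurableT_comp (@fine_measurable R setT _)) => //.
under eq_fun do rewrite integralE.
apply: emeasurable_funB; apply: measurable_fun_integral_kernel => //.
- by move=> U mU; exact: measurable_kernel.
- exact/measurable_funepos/measurable_EFinP.
- by move=> U mU; exact: measurable_kernel.
- exact/measurable_funeneg/measurable_EFinP.
Qed.

(** * Strong law under a conditional product law *)

(** A kernel value is only a measure as far as its type goes; carrying the proof [m1] in the name
    allows the probability structure to be attached to it. *)
Definition as_probability d (T : measurableType d) (R : realType)
  (m : {measure set T -> \bar R}) (m1 : m setT = 1%E) : set T -> \bar R := m.

HB.instance Definition _ d (T : measurableType d) (R : realType)
    (m : {measure set T -> \bar R}) (m1 : m setT = 1%E) :=
  Measure.on (as_probability m1).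

HB.instance Definition _ d (T : measurableType d) (R : realType)
    (m : {measure set T -> \bar R}) (m1 : m setT = 1%E) :=
  Measure_isProbability.Build _ _ _ (as_probability m1) m1.

(** The strong law holds under [k w] for almost every fixed [w]; [conditional_law_ae] carries it
    over to the random point [Y w]. *)
Lemma slln_conditional_product d (Omega : measurableType d) dE
    (E : measurableType dE) dF (F : measurableType dF) (R : realType)
    (P : probability Omega R) (Y : Omega -> seqspace E) (Z : Omega -> F)
    (k : R.-pker (g_sigma_algebra_preimageType Z) ~> seqspace E)
    (mu : Omega -> nat -> probability E R) (g : E -> R) (M : R) :
  measurable_fun setT Y -> measurable_fun setT Z ->
  regular_conditional_distribution P Y k ->
  {ae P, forall w, is_product_law (k w) (mu w)} ->
  measurable_fun setT g -> (forall a, `|g a| <= M) ->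
  {ae P, forall w, average (fun i => g (Y w i) - \int[mu w i]_a g a) @ \oo
    --> (0 : R)}.
Proof.
move=> mY mZ rcd prodk mg gM.
have mgi i : measurable_fun setT (fun y : seqspace E => g (y i)).
  exact: (measurableT_comp mg (measurable_coordinate i)).
(* Centering through [k] makes [h n] jointly measurable in the parameter and the sequence. *)
pose c i (w : g_sigma_algebra_preimageType Z) := \int[k w]_y g (y i).
pose h n (z : g_sigma_algebra_preimageType Z * seqspace E) :=
  average (fun i => g (z.2 i) - c i z.1) n.
have mh n : measurable_fun setT (h n).
  apply: measurable_funM => //; apply: measurable_sum => i.
  apply: measurable_funB; first exact: (measurableT_comp (mgi i)).
  have mc : measurable_fun setT (c i).
    exact: measurable_fun_Rintegral_kernel.
  exact: (measurableT_comp mc).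
pose Q w : probability (seqspace E) R :=
  as_probability (m := k w) (prob_kernel w).
have : {ae P, forall w, h^~ (w, Y w) @ \oo --> (0 : R)}.
  apply: (conditional_law_ae mY mZ rcd (measurable_cvg0 mh)).
  move: prodk; apply: (@filterS _ _ (ae_filter_ringOfSetsType P)) => w prodk.
  exact: (slln_product_law (Q := Q w) (g := g) prodk mg gM).
(* Where [k w] is a product law, its [i]-th mean is that of [mu w i], which restores the stated
   centering. *)
move: prodk; apply: (@filterS2 _ _ (ae_filter_ringOfSetsType P)) => w prodk.
rewrite /h /c /=.
have mE i := product_law_Rintegral (Q := Q w) i prodk mg gM.
rewrite (_ : (fun i => g (Y w i) - \int[k w]_y g (y i)) =
    (fun i => g (Y w i) - \int[mu w i]_a g a))//.
by apply/funext => i; congr (_ - _); exact: mE.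
Qed.

(** * Continuous functions on a compact space, and the conclusion *)

Lemma continuous_measurable_borel (R : realType) (S : ptopologicalType)
    (f : S -> R) :
  continuous f -> measurable_fun [set: borel S] f.
Proof.
move=> /continuousP cf; apply: (measurability _ (RGenOpens.measurableE R)).
move=> _ [_ [a [b ->] <-]]; rewrite setTI; apply: sub_sigma_algebra.
exact/cf/interval_open.
Qed.

Lemma compact_continuous_bounded (R : realType) (S : ptopologicalType)
    (f : S -> R) :
  compact [set: S] -> continuous f -> exists M, forall x, `|f x| <= M.
Proof.
move=> cS cf.
have /compact_bounded[M [_ fM]] : compact (f @` setT).
  by apply: continuous_compact => //; exact: continuous_subspaceT.
exists (M + 1) => x; apply: (fM (M + 1)); first by rewrite ltrDl.
by exists x.
Qed.

Lemma cvg_sub0_iff (R : realType) (a b : nat -> R) (l : R) :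
  (a \- b) @ \oo --> (0 : R) -> a @ \oo --> l <-> b @ \oo --> l.
Proof.
move=> ab; split=> [al|bl].
  have -> : b = a - (a \- b) by apply/funext => n; rewrite !fctE /=; ring.
  by rewrite -[l]subr0; exact: cvgB.
have -> : a = (a \- b) + b by apply/funext => n; rewrite !fctE /=; ring.
by rewrite -[l]add0r; exact: cvgD.
Qed.

Theorem theorem3p7 (R : realType) (S : ptopologicalType)
    (compactS : compact [set: S]) (metrizableS : metrizable R S)
    (d : measure_display) (Omega : measurableType d) (P : probability Omega R)
    (X : nat -> {RV P >-> borel S}) (xi : nat -> {RV P >-> M1 R S})
    (X_xi : product_disintegration X xi)
    (f : S -> R) (cf : continuous f) :
  [/\ {ae P, forall w,
        average (fun i => f (X i w) - mean (xi i w) f) @ \oo --> (0 : R)},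
      {ae P, forall w, cvgn (average (fun i => f (X i w)))} <->
      {ae P, forall w, cvgn (average (fun i => mean (xi i w) f))} &
      {ae P, forall w, cvgn (average (fun i => f (X i w)))} ->
      {ae P, forall w, limn (average (fun i => f (X i w))) =
                       limn (average (fun i => mean (xi i w) f))}].
Proof.
have [M fM] := compact_continuous_bounded compactS cf.
have slln : {ae P, forall w,
    average (fun i => f (X i w) - mean (xi i w) f) @ \oo --> (0 : R)}.
  have [k rcd prodk] := X_xi.
  apply: (slln_conditional_product (M := M)
    (mu := fun w i => xi i w : probability (borel S) R) _ _ rcd) => //.
  - exact: (measurable_fun_seqspace (h := fun n w => X n w)).
  - exact: (measurable_fun_seqspace (h := fun n w => xi n w)).
  - exact: continuous_measurable_borel.
(* For a fixed [w] the two averages differ by a null sequence, so they have the same limits; both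
   remaining claims follow pointwise. *)
have lim_iff w (l : R) :
  average (fun i => f (X i w) - mean (xi i w) f) @ \oo --> (0 : R) ->
  average (fun i => f (X i w)) @ \oo --> l <->
  average (fun i => mean (xi i w) f) @ \oo --> l.
  by rewrite averageB; exact: cvg_sub0_iff.
split => //.
- split; move: slln; apply: (@filterS2 _ _ (ae_filter_ringOfSetsType P)) => w.
    by move=> /lim_iff iff /cvg_ex[l cX]; apply: (cvgP l); apply/iff.
  by move=> /lim_iff iff /cvg_ex[l cX]; apply: (cvgP l); apply/iff.
move=> aeX; move: slln aeX.
apply: (@filterS2 _ _ (ae_filter_ringOfSetsType P)) => w /lim_iff iff cX.
by apply/esym/cvg_lim => //; apply/iff.
Qed.
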